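(* Let $T\in\mathbb{S}^m$ and let $T=U\Lambda U^\top$ be a diagonalization of $T$, with $U$ orthogonal and $\Lambda$ real diagonal. Then the projection of $T$ onto the free spectrahedron $\{W\in\mathbb{S}^m: W\succeq0,\ \mathrm{trace}(W)=1\}$ is given by $U[\Lambda]^+U^\top$.
   Context: $\mathbb{S}^m$ is the space of real symmetric $m\times m$ matrices with the Frobenius norm $\|A\|_F^2=\mathrm{trace}(A^2)$; projection onto a closed convex set of matrices means the nearest point in Frobenius norm. For a diagonal matrix $\Lambda$, $[\Lambda]^+$ is the diagonal matrix whose diagonal is the Euclidean projection of the diagonal of $\Lambda$ onto the probability simplex $\{x\in\mathbb{R}^m: x_k\ge0,\ \sum_kx_k=1\}$. *)

(* Defs.v *)
From HB Require Import structures.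
From mathcomp Require Export all_boot all_order all_algebra.
From mathcomp Require Export all_classical all_reals.

Set Implicit Arguments.
Unset Strict Implicit.
Unset Printing Implicit Defensive.

Import Order.TTheory GRing.Theory Num.Theory.

Local Open Scope classical_set_scope.
Local Open Scope ring_scope.

Definition is_nearest (R : realType) (V : zmodType) (N : V -> R) (C : set V)
    (x p : V) : Prop :=
  C p /\ forall q, C q -> N (x - p) <= N (x - q).

Definition is_projection (R : realType) (V : zmodType) (N : V -> R) (C : set V)
    (x p : V) : Prop :=
  is_nearest N C x p /\ forall q, is_nearest N C x q -> q = p.

(* The value is 0 when x has no unique nearest point in C; this does not occur
   for a nonempty closed convex C and a Euclidean norm N. *)
Definition proj (R : realType) (V : zmodType) (N : V -> R) (C : set V) (x : V)
    : V :=
  xget 0 [set p | is_projection N C x p].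

Definition l2norm (R : realType) (m : nat) (x : 'rV[R]_m) : R :=
  Num.sqrt (\sum_i x 0 i ^+ 2).

Definition simplex (R : realType) (m : nat) : set 'rV[R]_m :=
  [set x | (forall k, 0 <= x 0 k) /\ \sum_k x 0 k = 1].

(* Only meant for symmetric A; in general the Frobenius norm involves
   trace (A A^T). *)
Definition frobenius (R : realType) (m : nat) (A : 'M[R]_m) : R :=
  Num.sqrt (\tr (A *m A)).

Definition psd (R : realType) (m : nat) (A : 'M[R]_m) : Prop :=
  forall x : 'cV[R]_m, 0 <= (x^T *m A *m x) 0 0.

Definition free_spectrahedron (R : realType) (m : nat) : set 'M[R]_m :=
  [set W | [/\ W \is symmetricmx, psd W & \tr W = 1]].

Definition orthogonalmx (R : realType) (m : nat) (U : 'M[R]_m) : Prop :=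
  U^T *m U = 1%:M.

(* Lambda |-> [Lambda]^+ *)
Definition diag_simplex_proj (R : realType) (m : nat) (L : 'M[R]_m) : 'M[R]_m :=
  diag_mx (proj (@l2norm R m) (@simplex R m) (\row_i L i i)).

(* Main.v *)
(* The Frobenius norm and the free spectrahedron are invariant under conjugation
   by U, so T may be replaced by L, with diagonal l.  Let x be the projection of
   l onto the simplex.  For V in the free spectrahedron the diagonal v of V lies
   in the simplex, and since L - diag x is diagonal,
   <L - diag x, diag x - V> = <l - x, x - v> >= 0.  Hence
   |L - diag x|^2 + |diag x - V|^2 <= |L - V|^2, which gives both minimality and
   uniqueness. *)
Require Import Defs.
From mathcomp Require Import ring lra.
Set Implicit Arguments.
Unset Strict Implicit.
Unset Printing Implicit Defensive.

Import Order.TTheory GRing.Theory Num.Theory.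
Local Open Scope ring_scope.

Lemma symmetricmxE (R : realType) (m : nat) (A : 'M[R]_m) :
  (A \is symmetricmx) = (A == A^T).
Proof. by rewrite is_hermitianmxE expr0 scale1r map_mx_id. Qed.

(** Minimality follows by dropping [Q (p - q)]; a second nearest point [q] has
    [Q (x - q) <= Q (x - p)], which forces [Q (p - q) = 0]. The conditions on [Q] concern only the
    differences involved, because the trace of a square is known to be nonnegative only for
    symmetric matrices. *)
Lemma pythagoras_is_projection (R : realType) (V : zmodType) (Q : V -> R)
    (C : set V) (x p : V) :
    C p -> 0 <= Q (x - p) ->
    (forall q, C q -> 0 <= Q (p - q)) ->
    (forall q, C q -> Q (p - q) = 0 -> q = p) ->
    (forall q, C q -> Q (x - p) + Q (p - q) <= Q (x - q)) ->
  is_projection (fun v => Num.sqrt (Q v)) C x p.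
Proof.
move=> Cp Q0 Qge0 Qeq0 Qpyth.
have leQ q : C q -> Q (x - p) <= Q (x - q).
  by move=> Cq; apply: le_trans (Qpyth q Cq); rewrite lerDl Qge0.
split=> [|q [Cq /(_ _ Cp)]]; first by split=> // q /leQ /ler_wsqrtr.
rewrite ler_psqrt ?nnegrE ?(le_trans Q0 (leQ q Cq)) // => leqp.
apply: (Qeq0 _ Cq); apply/eqP; rewrite eq_le Qge0 // andbT.
by rewrite -(lerD2l (Q (x - p))) addr0 (le_trans (Qpyth _ Cq)).
Qed.

(* The threshold t is the maximum of (\sum_(k in A) l k - 1) / #|A| over the
   nonempty sets A; a maximizer A satisfies l k >= t on A and l k <= t off A. *)
Lemma simplex_threshold (R : realFieldType) (m : nat) (l : 'I_m -> R) :
    (0 < m)%N ->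
  exists t : R, \sum_k Num.max (l k - t) 0 = 1.
Proof.
move=> m_gt0; pose f (A : {set 'I_m}) := (\sum_(k in A) l k - 1) / #|A|%:R.
have T0 : [set: 'I_m] != finset.set0 by rewrite -card_gt0 cardsT card_ord.
case: (Order.TotalTheory.arg_maxP (P := fun A => A != finset.set0) f T0).
move=> A A0 maxA; set t := f A.
have card_neq0 (B : {set 'I_m}) : B != finset.set0 -> 0 < #|B|%:R :> R.
  by rewrite ltr0n card_gt0.
have sumB (B : {set 'I_m}) :
    \sum_(k in B) (l k - t) = \sum_(k in B) l k - t * #|B|%:R.
  by rewrite sumrB sumr_const mulr_natr.
(* Maximality of [t] with denominators cleared; the maximizer [A] attains equality. *)
have leB (B : {set 'I_m}) : \sum_(k in B) (l k - t) <= 1.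
  have [->|B0] := eqVneq B finset.set0; first by rewrite finset.big_set0 ler01.
  have := maxA _ B0; rewrite -/t /f sumB /= => h.
  have {h} : \sum_(k in B) l k - 1 <= t * #|B|%:R.
    by rewrite -ler_pdivrMr ?card_neq0.
  by lra.
have eqA : \sum_(k in A) (l k - t) = 1.
  by rewrite sumB /t /f divfK ?gt_eqF ?card_neq0//; ring.
exists t; rewrite (bigID (mem A)) /= -[RHS]addr0 -[in RHS]eqA.
congr (_ + _).
  apply: eq_bigr => k kA; apply/max_idPl.
  (* Removing [k] from [A] cannot raise the sum above 1, so [l k - t >= 0]; dually, adding an
     outside [k] gives [l k - t <= 0]. *)
  by have := leB (A :\ k); move: eqA; rewrite (big_setD1 k) //=; lra.
apply: big1 => k kA; apply/max_idPr.
by have := leB (k |: A); rewrite (big_setU1 _ kA) /= eqA; lra.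
Qed.

(* The obtuse-angle characterization of the nearest point. *)
Lemma simplex_variational (R : realType) (m : nat) (l : 'rV[R]_m) :
    (0 < m)%N ->
  exists2 x, @simplex R m x &
    forall y, @simplex R m y -> 0 <= \sum_k (l 0 k - x 0 k) * (x 0 k - y 0 k).
Proof.
move=> m_gt0; have [t sumt] := simplex_threshold (l 0) m_gt0.
pose x := \row_k Num.max (l 0 k - t) 0.
have xs : @simplex R m x.
  split=> [k|]; first by rewrite mxE le_max lexx orbT.
  by rewrite -sumt; apply: eq_bigr => k _; rewrite mxE.
exists x => // y [y0 y1].
(* This sum vanishes, as [x] and [y] both sum to 1. Termwise, either [l k - x k = t], or [x k = 0]
   and [l k <= t], where [y k >= 0] gives the bound. *)
apply: (@le_trans _ _ (\sum_k t * (x 0 k - y 0 k))).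
  by rewrite -mulr_sumr sumrB xs.2 y1 subrr mulr0.
apply: ler_sum => k _; have := y0 k; rewrite !mxE.
by case: (leP (l 0 k - t) 0) => *; nra.
Qed.

Lemma simplex_projE (R : realType) (m : nat) (l x : 'rV[R]_m) :
    @simplex R m x ->
    (forall y, @simplex R m y ->
      0 <= \sum_k (l 0 k - x 0 k) * (x 0 k - y 0 k)) ->
  proj (@l2norm R m) (@simplex R m) l = x.
Proof.
move=> xs xvar.
have sq_ge0 (z : 'rV[R]_m) : 0 <= \sum_i z 0 i ^+ 2.
  by apply: sumr_ge0 => i _; apply: sqr_ge0.
have [xn xu] : is_projection (@l2norm R m) (@simplex R m) l x.
  apply: pythagoras_is_projection => // [y _|y ys].
    move=> /psumr_eq0P h; apply/rowP => k; apply/esym/eqP.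
    have /eqP := h (fun i _ => sqr_ge0 _) k isT.
    by rewrite sqrf_eq0 !mxE subr_eq0.
  have {1}-> : \sum_i (l - y) 0 i ^+ 2 = \sum_i (l - x) 0 i ^+ 2
      + \sum_i (x - y) 0 i ^+ 2
      + 2 * \sum_k (l 0 k - x 0 k) * (x 0 k - y 0 k).
    rewrite mulr_sumr -!big_split /=; apply: eq_bigr => k _; rewrite !mxE.
    by ring.
  by rewrite lerDl mulr_ge0 ?ler0n ?xvar.
(* Existence and uniqueness hold, so [proj] does not fall back on its default 0. *)
apply: xget_unique => [//|y [yn _]]; exact: xu.
Qed.

Lemma mxtrace_sqr_sym (R : comNzRingType) (m : nat) (A : 'M[R]_m) :
  A^T = A -> \tr (A *m A) = \sum_i \sum_j A i j ^+ 2.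
Proof.
move=> A_sym; apply: eq_bigr => i _; rewrite mxE; apply: eq_bigr => j _.
by rewrite -[in X in _ * X]A_sym mxE.
Qed.

Lemma mxtrace_sqr_sym_ge0 (R : realDomainType) (m : nat) (A : 'M[R]_m) :
  A^T = A -> 0 <= \tr (A *m A).
Proof.
move=> /mxtrace_sqr_sym ->; apply: sumr_ge0 => i _.
by apply: sumr_ge0 => j _; apply: sqr_ge0.
Qed.

Lemma mxtrace_sqr_sym_eq0 (R : realDomainType) (m : nat) (A : 'M[R]_m) :
  A^T = A -> \tr (A *m A) = 0 -> A = 0.
Proof.
move=> /mxtrace_sqr_sym ->; rewrite pair_big /= => A0.
apply/matrixP => i j; rewrite mxE; apply/eqP; rewrite -sqrf_eq0; apply/eqP.
exact: (psumr_eq0P (fun p _ => sqr_ge0 (A p.1 p.2)) A0 (i := (i, j))).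
Qed.

(** The quadratic form at the [i]-th basis vector is [A i i]. *)
Lemma psd_diag_ge0 (R : realType) (m : nat) (A : 'M[R]_m) (i : 'I_m) :
  psd A -> 0 <= A i i.
Proof.
move=> /(_ (delta_mx i 0)).
by rewrite trmx_delta -rowE -colE !mxE.
Qed.

Lemma psd_congr (R : realType) (m : nat) (A B : 'M[R]_m) :
  psd A -> psd (B *m A *m B^T).
Proof. by move=> A0 x; have := A0 (B^T *m x); rewrite trmx_mul trmxK !mulmxA. Qed.

Lemma psd_diag_mx (R : realType) (m : nat) (d : 'rV[R]_m) :
  (forall k, 0 <= d 0 k) -> psd (diag_mx d).
Proof.
move=> d0 x; rewrite mul_mx_diag mxE sumr_ge0 // => k _; rewrite !mxE.
by have := d0 k; nra.
Qed.

Lemma free_spectrahedron_congr (R : realType) (m : nat) (U W : 'M[R]_m) :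
    orthogonalmx U -> @free_spectrahedron R m W ->
  @free_spectrahedron R m (U *m W *m U^T).
Proof.
move=> U_orth [W_sym W0 W1]; split; last 2 first.
- exact: psd_congr.
- by rewrite mxtrace_mulC mulmxA U_orth mul1mx.
move: W_sym; rewrite !symmetricmxE => /eqP W_sym.
by rewrite !trmx_mul trmxK -W_sym mulmxA.
Qed.

Lemma mxtrace_sqr_congr (R : realType) (m : nat) (U A : 'M[R]_m) :
    orthogonalmx U ->
  \tr (U *m A *m U^T *m (U *m A *m U^T)) = \tr (A *m A).
Proof.
move=> U_orth.
rewrite -!mulmxA mxtrace_mulC -!mulmxA U_orth mulmx1.
by rewrite (mulmxA U^T U) U_orth mul1mx.
Qed.

Lemma diag_mx_pythagoras (R : realType) (m : nat) (l x : 'rV[R]_m)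
    (V : 'M[R]_m) :
    0 <= \sum_k (l 0 k - x 0 k) * (x 0 k - V k k) ->
  \tr ((diag_mx l - diag_mx x) *m (diag_mx l - diag_mx x))
      + \tr ((diag_mx x - V) *m (diag_mx x - V))
    <= \tr ((diag_mx l - V) *m (diag_mx l - V)).
Proof.
move=> h; set L := diag_mx l; set D := diag_mx x.
have sqrD (A B : 'M[R]_m) : \tr ((A + B) *m (A + B)) =
    \tr (A *m A) + \tr (B *m B) + 2 * \tr (A *m B).
  by rewrite mulmxDl !mulmxDr !mxtraceD (mxtrace_mulC B A); ring.
have -> : L - V = (L - D) + (D - V) by rewrite addrA subrK.
rewrite (sqrD (L - D)) lerDl mulr_ge0 ?ler0n //.
(* Multiplying by the diagonal matrix [L - D] scales rows, so the trace reads only the diagonal of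
   [D - V]. *)
rewrite -raddfB /= mul_diag_mx; apply: le_trans h _.
by apply: ler_sum => k _; rewrite !mxE eqxx mulr1n.
Qed.

Theorem lemma4 (R : realType) (m : nat) (m_gt0 : (0 < m)%N)
    (T U L : 'M[R]_m)
    (T_sym : T \is symmetricmx)
    (U_orth : orthogonalmx U)
    (L_diag : is_diag_mx L)
    (T_diag : T = U *m L *m U^T) :
  is_projection (@frobenius R m) (@free_spectrahedron R m) T
    (U *m diag_simplex_proj L *m U^T).
Proof.
pose l := \row_i L i i.
have LE : L = diag_mx l.
  apply/matrixP => i j; rewrite !mxE; case: eqVneq => [->//|ij].
  by rewrite (is_diag_mxP L_diag).
have [x xs xvar] := simplex_variational l m_gt0.
have -> : diag_simplex_proj L = diag_mx x.
  by rewrite /diag_simplex_proj (simplex_projE xs xvar).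
set D := diag_mx x; have U_orthC : U *m U^T = 1%:M by apply: mulmx1C.
have Ds : @free_spectrahedron R m D.
  split; [by rewrite symmetricmxE tr_diag_mx | exact: psd_diag_mx xs.1 |].
  by rewrite mxtrace_diag xs.2.
have congrB A B : U *m A *m U^T - U *m B *m U^T = U *m (A - B) *m U^T.
  by rewrite mulmxBr mulmxBl.
(* Conjugation by [U] maps the spectrahedron onto itself, the preimage of [W] being its conjugate by
   the orthogonal matrix [U^T]; every competitor can thus be compared in the eigenbasis. *)
have specP W : @free_spectrahedron R m W -> exists2 V,
    W = U *m V *m U^T & @free_spectrahedron R m V.
  move=> Ws; exists (U^T *m W *m U).
    by rewrite !mulmxA U_orthC mul1mx -mulmxA U_orthC mulmx1.
  by rewrite -[X in _ *m X]trmxK; apply: free_spectrahedron_congr;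
    rewrite // /orthogonalmx trmxK.
have symV V : @free_spectrahedron R m V -> V^T = V.
  by case; rewrite symmetricmxE => /eqP.
have symB (A B : 'M[R]_m) : A^T = A -> B^T = B -> (A - B)^T = A - B.
  by move=> As Bs; rewrite linearB /= As Bs.
have D_sym : D^T = D := symV _ Ds.
rewrite T_diag; apply: pythagoras_is_projection.
- exact: (free_spectrahedron_congr U_orth Ds).
- rewrite congrB mxtrace_sqr_congr // mxtrace_sqr_sym_ge0 // symB //.
  by rewrite LE tr_diag_mx.
- move=> _ /specP[V -> Vs]; rewrite congrB mxtrace_sqr_congr //.
  exact: mxtrace_sqr_sym_ge0 (symB _ _ D_sym (symV _ Vs)).
- move=> _ /specP[V -> Vs]; rewrite congrB mxtrace_sqr_congr //.
  by move=> /(mxtrace_sqr_sym_eq0 (symB _ _ D_sym (symV _ Vs))) /subr0_eq ->.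
- move=> _ /specP[V -> Vs]; rewrite !congrB !mxtrace_sqr_congr // LE.
  apply: diag_mx_pythagoras.
  have [_ V0 V1] := Vs.
  have Vs' : @simplex R m (\row_k V k k).
    split=> [k|]; first by rewrite mxE psd_diag_ge0.
    by rewrite -V1; apply: eq_bigr => k _; rewrite mxE.
  apply: le_trans (xvar _ Vs') _.
  by under eq_bigr do rewrite [(\row_i V i i) _ _]mxE.
Qed.
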